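(* For every integer $t\ge 3$ we have $$n^2e^{-O(\sqrt{\log n})}\le \mathrm{ex}_{K_t}(n,K_3)=o(n^2)\qquad (n\to\infty),$$ where the implied constant in $O(\cdot)$ may depend on $t$.
   Context: For fixed nonempty simple graphs $F$ and $G$, $\mathrm{ex}_F(n,G)$ (the $F$-multicolor Turán number of $G$) denotes the maximum number of pairwise edge-disjoint copies of $F$ that can be placed on an $n$-element vertex set so that the union of these copies contains no subgraph isomorphic to $G$ all of whose edges belong to pairwise different copies of $F$ (i.e. coloring each copy of $F$ with its own color, there is no ''multicolor'' copy of $G$). $K_t$ denotes the complete graph on $t$ vertices. *)

(* Defs.v *)
From mathcomp Require Import all_boot.

Set Implicit Arguments.
Unset Strict Implicit.
Unset Printing Implicit Defensive.

Record sgraph := SGraph {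
  vertex :> finType;
  adj : rel vertex;
  adj_sym : symmetric adj;
  adj_irr : irreflexive adj }.

Definition edges (G : sgraph) : {set {set G}} :=
  [set [set u; v] | u : G, v : G in adj u].

Fact neq_sym (T : eqType) : symmetric [rel x y : T | x != y].
Proof. by move=> x y /=; rewrite eq_sym. Qed.

Fact neq_irr (T : eqType) : irreflexive [rel x y : T | x != y].
Proof. by move=> x /=; rewrite eqxx. Qed.

Definition complete (t : nat) : sgraph :=
  SGraph (@neq_sym 'I_t) (@neq_irr 'I_t).

Section Multicolor.
Variable V : finType.

(* A copy of G on V is represented by its edge set. Isolated vertices of G
   only require room in V: edge-disjoint copies of a graph with at least one
   edge have distinct edge sets, so no copy is lost when counting. *)
Definition is_copy (G : sgraph) (H : {set {set V}}) : bool :=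
  [exists f : {ffun G -> V},
    injectiveb f && (H == [set f @: e | e : {set G} in edges G])].

Definition packing (F : sgraph) (C : {set {set {set V}}}) : bool :=
  [forall S in C, is_copy F S] && trivIset C.

(* When C consists of pairwise disjoint sets and e lies in cover C,
   pblock C e is the unique member of C containing e, i.e. the colour of e. *)
Definition multicolor (C : {set {set {set V}}}) (H : {set {set V}}) : bool :=
  (H \subset cover C) && dinjectiveb (pblock C) H.

Definition multicolor_free (G : sgraph) (C : {set {set {set V}}}) : bool :=
  [forall H, is_copy G H ==> ~~ multicolor C H].

End Multicolor.

(* Meaningful when F and G have at least one edge; then the empty packing
   is always admissible. *)
Definition ex_multi (F : sgraph) (n : nat) (G : sgraph) : nat :=
  \max_(C : {set {set {set 'I_n}}} | packing F C && multicolor_free G C) #|C|.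

(* Main.v *)
Require Import Defs.
From mathcomp Require Import all_boot all_order all_algebra.
From mathcomp Require Import ring lra zify.
Set Implicit Arguments.
Unset Strict Implicit.
Unset Printing Implicit Defensive.
Import Order.TTheory GRing.Theory Num.Theory.
Local Open Scope ring_scope.

(** Upper bound. Choose vertices x, y, z in each copy of K_t. As there is no
    multicolor triangle, for each vertex c the edges {x, y} of the copies with
    z = c form an induced matching, so the claim is the Ruzsa-Szemeredi theorem
    that a union of n induced matchings on n vertices has o(n^2) edges. If there
    were too many edges, then for any bounded partition of the two vertex
    classes many edges would lie in a dense cell in which their matching covers
    a positive proportion of both sides; there the matching spans a rectangle
    containing only linearly many edges. Splitting each such cell along one of
    these rectangles raises the energy (mean square density) by a constant, which
    can happen only boundedly often.

    Lower bound. On vertices (i, u), with i < t and u an integer vector, place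
    for each x and each v on a fixed sphere the copy of K_t on (i, x + i v).
    A multicolor triangle would give three points of the sphere on a line, as in
    Behrend's construction. The dimension is about sqrt (log n). *)

(** * Energy of partitions *)

Lemma card_natr (R : pzSemiRingType) (X : finType) (P : pred X) :
  #|P|%:R = \sum_(x | P x) 1 :> R.
Proof. by rewrite -sum1_card natr_sum. Qed.

Lemma sum_condE (R : pzSemiRingType) (X : finType) (P : pred X) (F : X -> R) :
  \sum_(x | P x) F x = \sum_x F x * (P x)%:R.
Proof.
by rewrite big_mkcond; apply: eq_bigr => x _; case: (P x); rewrite ?mulr1 ?mulr0.
Qed.

Section ConditionalExpectation.
Variables (R : realFieldType) (X Y : finType) (f : X -> R) (pi : X -> Y).

(** Conditional expectation of [f] on the cell [y]. An empty cell gets the value 0. *)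
Definition fiber_mean (y : Y) : R :=
  (\sum_(x | pi x == y) f x) / #|[pred x | pi x == y]|%:R.

(** Unnormalised: summing over [X] weights each cell by its size, so [#|X|] replaces 1 as the
    trivial bound. *)
Definition energy : R := \sum_x fiber_mean (pi x) ^+ 2.

Lemma sum_fiber_mean (h : Y -> R) :
  \sum_x fiber_mean (pi x) * h (pi x) = \sum_x f x * h (pi x).
Proof.
rewrite (partition_big pi predT) //= [RHS](partition_big pi predT) //=.
apply: eq_bigr => y _.
rewrite (eq_bigr (fun _ => fiber_mean y * h y)); last by move=> x /eqP->.
rewrite [RHS](eq_bigr (fun x => f x * h y)); last by move=> x /eqP->.
rewrite -[RHS]mulr_suml -mulr_suml; congr (_ * _).
rewrite sumr_const -[LHS]mulr_natr /fiber_mean.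
have [y0|y0] := eqVneq #|[pred x | pi x == y]| 0%N.
  rewrite y0 mulr0 big_pred0 // => x.
  by have /card0_eq/(_ x) := y0; rewrite inE.
by rewrite divfK // pnatr_eq0.
Qed.

Lemma energy_le (f01 : forall x, 0 <= f x <= 1) : energy <= #|X|%:R.
Proof.
have E : energy = \sum_x f x * fiber_mean (pi x).
  by rewrite -(sum_fiber_mean fiber_mean); apply: eq_bigr => x _; rewrite expr2.
have : 0 <= \sum_x (f x - fiber_mean (pi x)) ^+ 2.
  by apply: sumr_ge0 => x _; exact: sqr_ge0.
under eq_bigr => x _ do rewrite sqrrB.
rewrite big_split /= sumrB -/energy sumrMnl -E.
have : \sum_x f x ^+ 2 <= #|X|%:R.
  rewrite card_natr; apply: ler_sum => x _.
  by case/andP: (f01 x) => f0 f1; rewrite expr_le1.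
rewrite /=; lra.
Qed.

End ConditionalExpectation.

(** On [D] the coarse mean is at least [eps], while the fine mean is at most [eps / 4] on average. A
    pointwise bound linear in the fine mean suffices, since only its sum over [D] is known; it
    yields [eps ^+ 2 * (1 - 1/4 - 1/4)] per point. *)
Lemma energy_gain (R : realFieldType) (X Y Y' : finType) (f : X -> R)
    (pi : X -> Y) (pi' : X -> Y') (rho : Y' -> Y) (D : pred Y') (eps : R) :
    (forall x, pi x = rho (pi' x)) -> 0 < eps ->
    (forall x, D (pi' x) -> eps <= fiber_mean f pi (pi x)) ->
    \sum_(x | D (pi' x)) f x <= eps / 4 * #|[pred x | D (pi' x)]|%:R ->
  energy f pi + eps ^+ 2 / 2 * #|[pred x | D (pi' x)]|%:R <= energy f pi'.
Proof.
move=> rhoE eps0 dense sparse.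
set d := fun x => fiber_mean f pi (pi x); set d' := fun x => fiber_mean f pi' (pi' x).
have projE h : \sum_x d' x * h (pi' x) = \sum_x f x * h (pi' x).
  exact: sum_fiber_mean.
have dd' : \sum_x d' x * d x = energy f pi.
  under eq_bigr => x _ do rewrite /d rhoE.
  rewrite (projE (fun y => fiber_mean f pi (rho y))).
  under eq_bigr => x _ do rewrite -rhoE.
  rewrite -(sum_fiber_mean f pi (fiber_mean f pi)).
  by apply: eq_bigr => x _; rewrite expr2.
(* Pythagoras, as d is the conditional expectation of d' *)
have sq : energy f pi' - energy f pi = \sum_x (d' x - d x) ^+ 2.
  under [RHS]eq_bigr => x _ do rewrite sqrrB.
  by rewrite big_split sumrB /= -/(energy f pi) -/(energy f pi') sumrMnl dd'; ring.
have lb : \sum_(x | D (pi' x)) (eps * (eps - d' x) - eps ^+ 2 / 4) <=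
          \sum_x (d' x - d x) ^+ 2.
  rewrite big_mkcond; apply: ler_sum => x _.
  case: ifP => [/dense|_]; last exact: sqr_ge0.
  rewrite -/(d x) => ed.
  have := sqr_ge0 (d x - d' x - eps / 2); nra.
have dD : \sum_(x | D (pi' x)) d' x = \sum_(x | D (pi' x)) f x.
  rewrite sum_condE [RHS]sum_condE; exact: (projE (fun y => (D y)%:R)).
have constD c : \sum_(x | D (pi' x)) c = c * #|[pred x | D (pi' x)]|%:R.
  by rewrite card_natr mulr_sumr; apply: eq_bigr => x _; rewrite mulr1.
move: lb; rewrite sumrB -mulr_sumr sumrB dD !constD -sq.
move: sparse => /(ler_wpM2l (ltW eps0)); lra.
Qed.

(** * Unions of induced matchings *)

(** Each class [(c, i)] of [(z, g)] counts only if it has fewer than [tau i] elements; sum over all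
    classes. *)
Lemma card_light (R : realFieldType) (V I T : finType) (z : I -> V) (g : I -> T)
    (tau : T -> R) :
    (forall i, 0 <= tau i) ->
  #|[pred s | #|[pred s' | (z s' == z s) && (g s' == g s)]|%:R < tau (g s)]|%:R
    <= #|V|%:R * \sum_i tau i.
Proof.
move=> tau0; rewrite card_natr (partition_big (fun s => (z s, g s)) predT) //=.
have -> : #|V|%:R * \sum_i tau i = \sum_(ci : V * T) tau ci.2.
  by rewrite -(pair_big predT predT (fun _ i => tau i)) /= sumr_const mulr_natl.
apply: ler_sum => -[c i] _ /=.
have [s0 /andP[s0lt /eqP[zs0 gs0]]|none] := pickP (fun s =>
    (#|[pred s' | (z s' == z s) && (g s' == g s)]|%:R < tau (g s)) &&
    ((z s, g s) == (c, i))).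
  rewrite -gs0; apply: le_trans (ltW s0lt); rewrite -card_natr ler_nat.
  apply/subset_leq_card/subsetP => s; rewrite !inE => /andP[_ /eqP[-> ->]].
  by rewrite zs0 gs0 !eqxx.
by rewrite big_pred0.
Qed.

Section InducedMatchings.
Variables (R : realFieldType) (V I : finType) (x y z : I -> V).
Hypothesis xy_inj : injective (fun s => (x s, y s)).
(* For each c the edges (x s, y s) with z s = c form an induced matching. *)
Hypothesis induced : forall s1 s2 s3,
  z s1 = z s2 -> x s3 = x s1 -> y s3 = y s2 -> s1 = s2.

Definition edge (ab : V * V) : R := (ab \in [set (x s, y s) | s : I])%:R.

Lemma sum_edge (F : V * V -> R) : \sum_s F (x s, y s) = \sum_ab edge ab * F ab.
Proof.
under [RHS]eq_bigr => ab _ do rewrite mulrC.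
rewrite -sum_condE big_imset //; exact: in2W.
Qed.

(** The case [s3 = s2] of [induced]: the edges of one class form a matching. *)
Lemma matching_x_inj c : {in [pred s | z s == c] &, injective x}.
Proof.
move=> s s'; rewrite !inE => /eqP zs /eqP zs' xE.
by apply: (@induced s s' s'); rewrite ?zs.
Qed.

Lemma matching_y_inj c : {in [pred s | z s == c] &, injective y}.
Proof.
move=> s s'; rewrite !inE => /eqP zs /eqP zs' yE.
by apply: (@induced s s' s); rewrite ?zs.
Qed.

(** An edge of the rectangle joins [x s1] to [y s2] with both indices in the class [c], so [induced]
    gives [s1 = s2]. Hence at most one edge leaves each point of [A]. *)
Lemma sum_edge_rect c (A B : {set V}) :
    {in A, forall a, exists2 s, z s = c & x s = a} ->
    {in B, forall b, exists2 s, z s = c & y s = b} ->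
  \sum_(ab in setX A B) edge ab <= #|A|%:R.
Proof.
move=> hA hB.
have -> : \sum_(ab in setX A B) edge ab =
    #|setX A B :&: [set (x s, y s) | s : I]|%:R.
  rewrite -sum1_card natr_sum [LHS]sum_condE [RHS]sum_condE; apply: eq_bigr => ab _.
  by rewrite in_setI andbC -mulnb natrM mul1r.
suff uniq_y s1 b : z s1 = c ->
    (x s1, b) \in setX A B :&: [set (x s, y s) | s : I] -> b = y s1.
  rewrite ler_nat -(card_in_imset (f := @fst V V)).
    apply/subset_leq_card/subsetP => a /imsetP[[a' b]].
    by rewrite !inE /= => /andP[/andP[aA _] _] ->.
  move=> [a b] [a' b'] abE abE' /= aa'; subst a'; congr (_, _).
  have /hA[s1 zs1 xs1] : a \in A by move: abE; rewrite !inE /= => /andP[/andP[]].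
  by subst a; rewrite (uniq_y _ _ zs1 abE) (uniq_y _ _ zs1 abE').
move=> zs1; rewrite !inE /= => /andP[/andP[_ /hB[s2 zs2 <-]]].
by case/imsetP => s3 _ [xs3 ys3]; rewrite (@induced s1 s2 s3) // zs1.
Qed.

Definition prod_part (T : Type) (p q : V -> T) (ab : V * V) := (p ab.1, q ab.2).

(** The chosen rectangles cover at least [eps ^+ 3 * N ^+ 2] pairs and have density at most
    [eps / 4], inside cells of density at least [eps]; [energy_gain] then gives [eps ^+ 5 / 2]. *)
Lemma energy_increment (T : finType) (p q : V -> T) (eps : R) :
    0 < eps -> #|T|%:R <= eps ^+ 2 / 4 * #|V|%:R ->
    5 * eps * #|V|%:R ^+ 2 <= #|I|%:R ->
  exists p' q' : V -> T * {set T},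
    energy edge (prod_part p q) + eps ^+ 5 / 2 * #|V|%:R ^+ 2 <=
    energy edge (prod_part p' q').
Proof.
move=> eps0 TleV IgeV.
set N : R := #|V|%:R in TleV IgeV *; set k : R := #|T|%:R in TleV.
set pi := prod_part p q.
pose dense s := eps <= fiber_mean edge pi (pi (x s, y s)).
pose A i : R := #|[pred a | p a == i]|%:R.
pose B j : R := #|[pred b | q b == j]|%:R.
(* The extra term in [ty] forces rectangles of height at least [eps * N / k], hence at least
   [4 / eps]. Only this side needs it, as a rectangle has at most as many edges as its width. *)
pose tx i := eps * A i; pose ty j := eps * B j + eps * N / k.
pose fiber (g : I -> T) s := #|[pred s' | (z s' == z s) && (g s' == g s)]|.
pose hx s := tx (p (x s)) <= (fiber (p \o x) s)%:R.
pose hy s := ty (q (y s)) <= (fiber (q \o y) s)%:R.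
pose good s := [&& dense s, hx s & hy s].
have N0 : 0 <= N by exact: ler0n.
have k0 : 0 <= k by exact: ler0n.
have sumN (g : V -> T) : \sum_i #|[pred a | g a == i]|%:R = N.
  rewrite /N card_natr (partition_big g predT) //=.
  by apply: eq_bigr => i _; rewrite card_natr; apply: eq_bigl => a; rewrite inE.
have sumtx : \sum_i tx i = eps * N by rewrite -mulr_sumr sumN.
have sumty : \sum_j ty j = eps * N + eps * N / k * k.
  by rewrite big_split /= -mulr_sumr sumN sumr_const -[_ *+ #|T|]mulr_natr.
(* Whether a cell is dense depends on the cell alone, so [edge] may be replaced by its cell mean,
   which is below [eps] on these cells. *)
have cndense : \sum_s (~~ dense s)%:R <= eps * N ^+ 2.
  rewrite /dense (sum_edge (fun ab => (~~ (eps <= fiber_mean edge pi (pi ab)))%:R)).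
  rewrite -(sum_fiber_mean edge pi (fun u => (~~ (eps <= fiber_mean edge pi u))%:R)).
  have -> : eps * N ^+ 2 = \sum_(ab : V * V) eps.
    by rewrite sumr_const card_prod -[RHS]mulr_natr natrM expr2.
  by apply: ler_sum => ab _; case: (lerP eps) => [_|/ltW]; rewrite ?mulr0 ?mulr1 // ltW.
have clx : \sum_s (~~ hx s)%:R <= eps * N ^+ 2.
  have := @card_light R V I T z (p \o x) tx.
  rewrite sumtx -/N card_natr sum_condE => cl.
  apply: le_trans (_ : _ <= N * (eps * N)) _; last by lra.
  apply: le_trans (cl _); last by move=> i; rewrite mulr_ge0 // ?ltW.
  by apply: ler_sum => s _; rewrite mul1r /hx -ltNge.
have cly : \sum_s (~~ hy s)%:R <= 2 * eps * N ^+ 2.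
  have := @card_light R V I T z (q \o y) ty.
  rewrite sumty -/N card_natr sum_condE => cl.
  apply: le_trans (_ : _ <= N * (eps * N + eps * N / k * k)) _; last first.
    have [->|kn0] := eqVneq k 0; last by rewrite divfK //; lra.
    by rewrite mulr0; nra.
  apply: le_trans (cl _); last first.
    by move=> j; rewrite addr_ge0 ?divr_ge0 ?mulr_ge0 // ?ltW.
  by apply: ler_sum => s _; rewrite mul1r /hy -ltNge.
(* Of the [5 * eps * N ^+ 2] edges, sparse cells and light classes cost at most 1 + 1 + 2 parts. *)
have cgood : eps * N ^+ 2 <= \sum_s (good s)%:R.
  have : #|I|%:R <= \sum_s ((good s)%:R + (~~ dense s)%:R + (~~ hx s)%:R + (~~ hy s)%:R) :> R.
    rewrite card_natr; apply: ler_sum => s _; rewrite /good.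
    by case: (dense s); case: (hx s); case: (hy s); rewrite /= -?natrD ler1n.
  rewrite !big_split /=; lra.
(* The cell (i, j) is split along the rectangle spanned by the matching of one
   of its good edges, if it has any. *)
pose chosen i j := [pick s | good s && (pi (x s, y s) == (i, j))].
(* Besides its old class, each vertex records for which cells it lies on a side of the chosen
   rectangle, so one refinement splits all cells at once. *)
pose p' a := (p a, [set j | if chosen (p a) j is Some s
                            then [exists s', (z s' == z s) && (x s' == a)] else false]).
pose q' b := (q b, [set i | if chosen i (q b) is Some s
                            then [exists s', (z s' == z s) && (y s' == b)] else false]).
exists p', q'.
(* Read off from the refined classes: the pair lies in the rectangle chosen in its own cell. *)
pose D (u : (T * {set T}) * (T * {set T})) := (u.2.1 \in u.1.2) && (u.1.1 \in u.2.2).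
set pi' := prod_part p' q'.
pose cell ij := [pred ab | D (pi' ab) && (pi ab == ij)].
have cellP ij : if chosen ij.1 ij.2 is Some s then
     exists U W : {set V}, [/\ cell ij =i setX U W,
       tx ij.1 <= #|U|%:R, ty ij.2 <= #|W|%:R,
       \sum_(ab in setX U W) edge ab <= #|U|%:R & good s]
   else cell ij =i pred0.
  case: ij => i j; rewrite /= /cell /D.
  case Eij: (chosen i j) => [s|]; last first.
    move=> [a b]; rewrite !inE /=; apply/negP => /andP[H /eqP[ai bj]].
    by move: H; rewrite ai bj Eij.
  have [gs [pxs qys]] : good s /\ (p (x s) = i /\ q (y s) = j).
    by move: Eij; rewrite /chosen; case: pickP => // s' /andP[? /eqP[]] + + [<-].
  pose U := [set x s' | s' in [pred s' | (z s' == z s) && (p (x s') == p (x s))]].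
  pose W := [set y s' | s' in [pred s' | (z s' == z s) && (q (y s') == q (y s))]].
  have cU : #|U| = fiber (p \o x) s.
    rewrite card_in_imset // => s1 s2; rewrite !inE => /andP[z1 _] /andP[z2 _].
    exact: (@matching_x_inj (z s)).
  have cW : #|W| = fiber (q \o y) s.
    rewrite card_in_imset // => s1 s2; rewrite !inE => /andP[z1 _] /andP[z2 _].
    exact: (@matching_y_inj (z s)).
  have /and3P[_ hxs hys] := gs.
  exists U, W; split=> //.
  - move=> [a b]; rewrite !inE /=; apply/idP/idP.
      case/andP => + /eqP[ai bj]; rewrite ai bj Eij.
      case/andP=> /existsP[s1 /andP[z1 /eqP x1]] /existsP[s2 /andP[z2 /eqP y2]].
      apply/andP; split; apply/imsetP; [exists s1 | exists s2] => //; rewrite inE ?z1 ?z2 /=.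
        by rewrite x1 ai pxs.
      by rewrite y2 bj qys.
    case/andP => /imsetP[s1 /andP[z1 /eqP ps1] ->] /imsetP[s2 /andP[z2 /eqP qs2] ->].
    rewrite ps1 qs2 pxs qys Eij /pi /prod_part /= ps1 qs2 pxs qys eqxx andbT.
    by apply/andP; split; apply/existsP; [exists s1 | exists s2]; rewrite ?z1 ?z2 eqxx.
  - by rewrite cU -pxs.
  - by rewrite cW -qys.
  - apply: (@sum_edge_rect (z s)).
      by move=> a /imsetP[s' /andP[/eqP ? _] ->]; exists s'.
    by move=> a /imsetP[s' /andP[/eqP ? _] ->]; exists s'.
have AB0 i j : 0 <= A i /\ 0 <= B j by rewrite !ler0n.
have cards ij : eps ^+ 2 * (chosen ij.1 ij.2 : bool)%:R * (A ij.1 * B ij.2) <= #|cell ij|%:R.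
  move: (cellP ij); case: (chosen _ _) => [s [U [W [cellE tU tW _ _]]]|_]; last first.
    by rewrite mulr0 mul0r.
  have [A0 B0] := AB0 ij.1 ij.2.
  rewrite (eq_card cellE) cardsX natrM mulr1 expr2 mulrACA; 
  apply: ler_pM => //; try by rewrite mulr_ge0 // ltW.
  by apply: le_trans tW; rewrite lerDl divr_ge0 // mulr_ge0 // ltW.
have sparse ij : \sum_(ab | cell ij ab) edge ab <= eps / 4 * #|cell ij|%:R.
  move: (cellP ij); case: (chosen _ _) => [s [U [W [cellE tU tW eUW _]]]|cellE]; last first.
    rewrite (big_pred0 _ _ _ _ cellE); apply: mulr_ge0 => //.
    by apply: divr_ge0 => //; exact: ltW.
  have kpos : 0 < k by rewrite ltr0n; apply/card_gt0P; exists ij.1.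
  rewrite (eq_bigl (mem (setX U W)) _ cellE) (eq_card cellE) cardsX natrM.
  apply: le_trans eUW _; rewrite mulrCA ler_peMr //.
  have [A0 B0] := AB0 ij.1 ij.2.
  have : eps * N / k <= #|W|%:R.
    by apply: le_trans tW; rewrite lerDr mulr_ge0 // ltW.
  rewrite ler_pdivrMr // => {}tW.
  rewrite -(ler_pM2r kpos); nra.
(* Every good edge lies in a cell with a chosen rectangle, so these cells contain at least
   [eps * N ^+ 2] pairs; each rectangle fills a proportion [eps ^+ 2] of its cell. *)
have cD : eps ^+ 3 * N ^+ 2 <= #|[pred ab | D (pi' ab)]|%:R.
  have ABE i j : A i * B j = \sum_(ab | pi ab == (i, j)) 1.
    rewrite /A /B !card_natr big_distrlr /= pair_big /=.
    by apply: eq_big => [[a b]|ab _]; rewrite ?mulr1 // !inE.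
  rewrite card_natr (partition_big pi predT) //=.
  apply: le_trans (_ : \sum_ij eps ^+ 2 * (chosen ij.1 ij.2 : bool)%:R *
                                  (A ij.1 * B ij.2) <= _); last first.
    apply: ler_sum => ij _; apply: le_trans (cards ij) _; rewrite card_natr.
    exact: lexx.
  rewrite (_ : \sum_ij _ =
    eps ^+ 2 * \sum_ab (chosen (pi ab).1 (pi ab).2 : bool)%:R); last first.
    rewrite [in RHS](partition_big pi predT) //= mulr_sumr; apply: eq_bigr => -[i j] _.
    rewrite ABE -mulrA; congr (_ * _); rewrite mulr_sumr.
    apply: eq_bigr => -[a b] /eqP[/= -> ->].
    by rewrite mulr1.
  rewrite exprS mulrC mulrA [N ^+ 2 * _]mulrC mulrC ler_wpM2l ?sqr_ge0 //.
  apply: le_trans cgood _.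
  apply: le_trans (_ : \sum_s (chosen (pi (x s, y s)).1 (pi (x s, y s)).2 : bool)%:R <= _).
    apply: ler_sum => s _; case gs: (good s) => //=; rewrite /chosen.
    by case: pickP => [//|/(_ s)]; rewrite gs eqxx.
  rewrite (sum_edge (fun ab => (chosen (pi ab).1 (pi ab).2 : bool)%:R)).
  apply: ler_sum => ab _; rewrite /edge; case: (_ \in _); rewrite ?mul1r ?mul0r //.
apply: le_trans (_ : energy edge pi + eps ^+ 2 / 2 * #|[pred ab | D (pi' ab)]|%:R <= _).
  by rewrite lerD2l (exprD eps 2 3); nra.
apply: (@energy_gain R _ _ _ edge pi pi' (fun u => (u.1.1, u.2.1)) D eps) => //.
- move=> ab Dab; move: (cellP (pi ab)); rewrite /chosen; case: pickP => [s|_].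
    move=> /andP[_ /eqP piE] [U [W [_ _ _ _ /and3P[+ _ _]]]].
    by rewrite /dense piE -surjective_pairing.
  by move/(_ ab); rewrite !inE Dab eqxx.
- rewrite (partition_big pi predT) //= card_natr [in leRHS](partition_big pi predT) //=.
  rewrite mulr_sumr; apply: ler_sum => ij _; apply: le_trans (sparse ij) _.
  rewrite card_natr; exact: lexx.
Qed.
End InducedMatchings.

(** Iterates the increment [m] times. The label type depends only on [eps] and [m], so a threshold
    on [#|V|] uniform over all configurations meets the size condition at each step. *)
Lemma energy_unbounded (R : archiRealFieldType) (eps : R) (eps0 : 0 < eps) (m : nat) :
  exists (T : finType) (n0 : nat), forall (V I : finType) (x y z : I -> V),
    injective (fun s => (x s, y s)) ->
    (forall s1 s2 s3, z s1 = z s2 -> x s3 = x s1 -> y s3 = y s2 -> s1 = s2) ->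
    (n0 <= #|V|)%N -> 5 * eps * #|V|%:R ^+ 2 <= #|I|%:R ->
  exists p q : V -> T,
    m%:R * (eps ^+ 5 / 2) * #|V|%:R ^+ 2 <= energy (edge R x y) (prod_part p q).
Proof.
elim: m => [|m [T [n0 IH]]].
  exists unit, 0%N => V I x y z _ _ _ _; exists (fun=> tt), (fun=> tt).
  by rewrite !mul0r; apply: sumr_ge0 => ab _; exact: sqr_ge0.
have e20 : 0 < eps ^+ 2 / 4 by apply: divr_gt0 => //; exact: exprn_gt0.
exists (T * {set T})%type, (maxn n0 (Num.bound (#|T|%:R / (eps ^+ 2 / 4)))).
move=> V I x y z xy_inj ind; rewrite geq_max => /andP[n0V boundV] IgeV.
have [p [q pqE]] := IH V I x y z xy_inj ind n0V IgeV.
have TleV : #|T|%:R <= eps ^+ 2 / 4 * #|V|%:R.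
  rewrite mulrC -ler_pdivrMr //; apply/ltW/(lt_le_trans (archi_boundP _)).
    by apply: divr_ge0 => //; exact: ltW.
  by rewrite ler_nat.
have [p' [q' incr]] := energy_increment xy_inj ind p q eps0 TleV IgeV.
exists p', q'; apply: le_trans incr; rewrite -natr1; move: pqE; lra.
Qed.

Lemma card_induced_matchings (R : archiRealFieldType) (delta : R) : 0 < delta ->
  exists n0 : nat, forall (V I : finType) (x y z : I -> V),
    injective (fun s => (x s, y s)) ->
    (forall s1 s2 s3, z s1 = z s2 -> x s3 = x s1 -> y s3 = y s2 -> s1 = s2) ->
    (n0 <= #|V|)%N -> #|I|%:R <= delta * #|V|%:R ^+ 2.
Proof.
move=> delta0; pose eps := delta / 5.
have eps0 : 0 < eps by exact: divr_gt0.
have e50 : 0 < eps ^+ 5 / 2 by apply: divr_gt0 => //; exact: exprn_gt0.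
(* More than [2 / eps ^+ 5] increments would push the energy above its trivial bound [#|V| ^+ 2]. *)
have [T [n0 H]] := energy_unbounded eps0 (Num.bound (1 / (eps ^+ 5 / 2))).
exists n0.+1 => V I x y z xy_inj ind nV; apply: contraT; rewrite -ltNge => /ltW big_I.
have [|p [q]] := H V I x y z xy_inj ind (ltnW nV).
  by apply: le_trans big_I; rewrite /eps; lra.
have V0 : 0 < #|V|%:R ^+ 2 :> R by rewrite exprn_gt0 // ltr0n; apply: leq_trans nV.
have : energy (edge R x y) (prod_part p q) <= #|V|%:R ^+ 2.
  rewrite expr2 -natrM -card_prod; apply: energy_le => ab.
  by rewrite /edge ler0n lern1 leq_b1.
move=> le1 le2; have := le_trans le2 le1.
rewrite leNgt -[X in X < _]mul1r ltr_pM2r // -ltr_pdivrMr // archi_boundP //.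
by apply: divr_ge0 => //; exact: ltW.
Qed.

(** * Upper bound: from packings to induced matchings *)

Lemma mem_complete_image (t : nat) (V : finType) (f : complete t -> V) (e : {set V}) :
  reflect (exists i j : 'I_t, i != j /\ e = [set f i; f j])
          (e \in [set f @: e' | e' : {set complete t} in edges (complete t)]).
Proof.
apply: (iffP imsetP) => [[e' /imset2P[i j _ ij ->] ->]|[i [j [ij ->]]]].
  by exists i, j; rewrite imsetU1 imset_set1.
exists [set i; j]; last by rewrite imsetU1 imset_set1.
by apply/imset2P; exists i j.
Qed.

Lemma triangle_is_copy (V : finType) (a b c : V) : a != b -> b != c -> a != c ->
  is_copy (complete 3) [set [set a; b]; [set b; c]; [set a; c]].
Proof.
move=> ab bc ac; pose f (i : 'I_3) := nth a [:: a; b; c] i.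
apply/existsP; exists [ffun i : complete 3 => f i]; apply/andP; split.
  apply/injectiveP => i j; rewrite !ffunE => /eqP fij; apply/val_inj/eqP.
  by rewrite -(nth_uniq a (s := [:: a; b; c])) ?ltn_ord //= !inE negb_or ab ac bc.
apply/eqP/setP => e; apply/idP/mem_complete_image.
  rewrite !inE -orbA => /or3P[] /eqP->.
  - by exists ord0, (inord 1); rewrite !ffunE /f /= -val_eqE /= inordK.
  - by exists (inord 1), (inord 2); rewrite !ffunE /f /= -val_eqE /= !inordK.
  - by exists ord0, (inord 2); rewrite !ffunE /f /= -val_eqE /= !inordK.
move=> [[[|[|[|//]]] ?] [[[|[|[|//]]] ?] []]]; rewrite // !ffunE /f /= => _ ->;
  by rewrite !inE ?eqxx ?orbT // setUC eqxx ?orbT.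
Qed.

(** The index set of the matchings is the packing itself. A violation of inducedness is a triangle
    with edges in [S1], [S2], [S3], which must repeat a colour. *)
Lemma ex_multi_triangle_upper (R : archiRealFieldType) (t : nat) (delta : R) :
    (3 <= t)%N -> 0 < delta ->
  exists n0 : nat, forall n, (n0 <= n)%N ->
    (ex_multi (complete t) n (complete 3))%:R <= delta * n%:R ^+ 2.
Proof.
move=> t3 delta0; have [n0 H] := card_induced_matchings delta0; exists n0 => n n0n.
rewrite /ex_multi; elim/big_ind: _ => [|a b|C].
- by rewrite mulr_ge0 ?sqr_ge0 // ltW.
- by move=> ? ?; case: (leqP a b).
case/andP => /andP[/forall_inP copies /trivIsetP disj] /forallP free.
have t0 : (0 < t)%N by apply: leq_trans t3.
have t1 : (1 < t)%N by apply: leq_trans t3.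
pose i0 : 'I_t := Ordinal t0; pose i1 : 'I_t := Ordinal t1; pose i2 : 'I_t := Ordinal t3.
have embP (S : {S | S \in C}) : exists f : {ffun 'I_t -> 'I_n}, injectiveb f &&
    [forall i, forall j, (i != j) ==> ([set f i; f j] \in val S)].
  have /existsP[f /andP[f_inj /eqP SE]] := copies _ (valP S).
  exists f; rewrite f_inj; apply/forallP => i; apply/forallP => j; apply/implyP => ij.
  by rewrite SE; apply/mem_complete_image; exists i, j.
pose f S := xchoose (embP S).
have f_inj S : injective (f S) by apply/injectiveP; case/andP: (xchooseP (embP S)).
have f_edge S i j : i != j -> [set f S i; f S j] \in val S.
  by case/andP: (xchooseP (embP S)) => _ /forallP/(_ i)/forallP/(_ j)/implyP.
have same (S S' : {S | S \in C}) e : e \in val S -> e \in val S' -> S = S'.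
  move=> eS eS'; apply: contraTeq isT => SS'.
  have /disjointFr/(_ eS) := disj _ _ (valP S) (valP S') SS'.
  by rewrite eS'.
have := H 'I_n {S | S \in C} (f^~ i0) (f^~ i1) (f^~ i2); rewrite card_sig card_ord.
apply => // [S S' [S0 S1]|S1 S2 S3 z12 x31 y32].
  by apply: (same _ _ [set f S i0; f S i1]); rewrite ?f_edge // S0 S1 f_edge.
have e1 : [set f S1 i0; f S1 i2] \in val S1 by rewrite f_edge.
have e2 : [set f S2 i1; f S1 i2] \in val S2 by rewrite z12 f_edge.
have e3 : [set f S1 i0; f S2 i1] \in val S3 by rewrite -x31 -y32 f_edge.
set a := f S1 i0 in e1 e3; set b := f S2 i1 in e2 e3; set c := f S1 i2 in e1 e2.
have ab : a != b by rewrite /a /b -x31 -y32 (inj_eq (f_inj _)).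
have bc : b != c by rewrite /b /c z12 (inj_eq (f_inj _)).
have ac : a != c by rewrite /a /c (inj_eq (f_inj _)).
have := free [set [set a; b]; [set b; c]; [set a; c]].
rewrite triangle_is_copy //= /multicolor negb_and.
have cov (S : {S | S \in C}) e : e \in val S -> e \in cover C.
  by move=> eS; apply/bigcupP; exists (val S) => //; exact: valP.
have pb (S : {S | S \in C}) e : e \in val S -> pblock C e = val S.
  move=> eS; apply: def_pblock => //; last exact: valP.
  by apply/trivIsetP.
case/orP => [/subsetPn[e]|/dinjectivePn[e eH [e' /andP[ee' e'H]]]].
  by rewrite !inE -orbA => /or3P[] /eqP->;
    [rewrite (cov S3)|rewrite (cov S2)|rewrite (cov S1)].
(* If [S3] coincides with one of the other two copies, that copy contains edges of both, and
   edge-disjointness gives [S1 = S2]. *)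
have f1 : S3 = S1 -> S1 = S2.
  by move=> E; apply: (same _ _ [set b; c]) => //; rewrite /b -y32 E f_edge.
have f2 : S3 = S2 -> S1 = S2.
  by move=> E; apply: (same _ _ [set a; c]) => //; rewrite /a -x31 E /c z12 f_edge.
move: ee' eH e'H; rewrite !inE -!orbA => ee' /or3P[] /eqP eE /or3P[] /eqP e'E;
  move: ee'; rewrite eE e'E ?eqxx // !(pb S1 _ e1, pb S2 _ e2, pb S3 _ e3);
  move=> _ /val_inj //; auto.
Qed.

(** * Copies indexed by points of a sphere *)

Lemma set2_inj (T : finType) (a b c d : T) : a != b -> [set a; b] = [set c; d] ->
  (a = c /\ b = d) \/ (a = d /\ b = c).
Proof.
move=> ab E; have : a \in [set c; d] by rewrite -E !inE eqxx.
have : b \in [set c; d] by rewrite -E !inE eqxx orbT.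
rewrite !inE => /orP[] /eqP bE /orP[] /eqP aE; subst; rewrite ?eqxx // in ab *;
  by [left | right].
Qed.

Section PartiteCopies.
Variables (t n : nat) (I : finType) (phi : I -> 'I_t -> 'I_n).
Hypothesis t_gt1 : (1 < t)%N.
Hypothesis partite : forall s s' i i', phi s i = phi s' i' -> i = i'.
Hypothesis linear : forall s s' i j,
  i != j -> phi s i = phi s' i -> phi s j = phi s' j -> s = s'.
Hypothesis no_triangle : forall s1 s2 s3 i j k, i != j -> j != k -> i != k ->
  phi s1 i = phi s3 i -> phi s1 j = phi s2 j -> phi s2 k = phi s3 k -> s1 = s2.

Let f s : {ffun complete t -> 'I_n} := [ffun i : 'I_t => phi s i].
Let E s : {set {set 'I_n}} := [set f s @: e | e : {set complete t} in edges (complete t)].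

Lemma partite_edgeP s e :
  reflect (exists i j, i != j /\ e = [set phi s i; phi s j]) (e \in E s).
Proof.
by apply: (iffP (mem_complete_image _ _)) => -[i [j [ij ->]]]; exists i, j; rewrite !ffunE.
Qed.

Lemma phi_inj s : injective (phi s).
Proof. by move=> i j; exact: partite. Qed.

Lemma partite_edge_inj s s' e : e \in E s -> e \in E s' -> s = s'.
Proof.
case/partite_edgeP => i [j [ij ->]] /partite_edgeP[i' [j' [_ eE]]].
have ij' : phi s i != phi s j by rewrite (inj_eq (@phi_inj s)).
have [[iE jE]|[iE jE]] := set2_inj ij' eE; apply: (linear ij).
- by rewrite iE (partite iE).
- by rewrite jE (partite jE).
- by rewrite iE (partite iE).
- by rewrite jE (partite jE).
Qed.

Lemma partite_edge_ex s : exists e, e \in E s.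
Proof.
exists [set phi s (Ordinal (ltnW t_gt1)); phi s (Ordinal t_gt1)].
by apply/partite_edgeP; exists (Ordinal (ltnW t_gt1)), (Ordinal t_gt1).
Qed.

(** By [linear] the copies [E s] are edge-disjoint. In a multicolor triangle, [partite] makes the
    two edges at each vertex agree on its part, so [no_triangle] applies and two edges share a
    colour. *)
Lemma ex_multi_partite_lower : (#|I| <= ex_multi (complete t) n (complete 3))%N.
Proof.
have E_inj : injective E.
  move=> s s' EE; have [e es] := partite_edge_ex s.
  by apply: (partite_edge_inj es); rewrite -EE.
pose C := [set E s | s : I].
have -> : #|I| = #|C| by rewrite card_imset.
have trivC : trivIset C.
  apply/trivIsetP => _ _ /imsetP[s _ ->] /imsetP[s' _ ->]; apply: contraR.
  by case/pred0Pn => e /andP[es es']; rewrite (partite_edge_inj es es').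
have pb s e : e \in E s -> pblock C e = E s.
  by move=> es; apply: def_pblock => //; exact: imset_f.
apply: (@leq_bigmax_cond _ (fun C => packing (complete t) C && multicolor_free (complete 3) C)
          (fun C => #|C|) C).
rewrite /packing trivC andbT; apply/andP; split.
  apply/forall_inP => _ /imsetP[s _ ->]; apply/existsP; exists (f s); rewrite eqxx andbT.
  by apply/injectiveP => i j; rewrite !ffunE; exact: partite.
apply/forallP => H; apply/implyP => /existsP[g /andP[/injectiveP g_inj /eqP HE]].
apply/negP => /andP[/subsetP Hcov /dinjectiveP Hinj].
have color a b : a != b -> exists s i j,
    [/\ [set g a; g b] \in H, [set g a; g b] \in E s, i != j, g a = phi s i & g b = phi s j].
  move=> ab; have abH : [set g a; g b] \in H.
    by rewrite HE; apply/mem_complete_image; exists a, b.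
  have /bigcupP[_ /imsetP[s _ ->] abE] := Hcov _ abH.
  have /partite_edgeP[i [j [ij eE]]] := abE.
  have gab : g a != g b by rewrite (inj_eq g_inj).
  have [[ga gb]|[ga gb]] := set2_inj gab eE; first by exists s, i, j.
  by exists s, j, i; rewrite eq_sym.
pose o1 : 'I_3 := inord 1; pose o2 : 'I_3 := inord 2.
have d01 : (ord0 : 'I_3) != o1 by rewrite -val_eqE /= inordK.
have d12 : o1 != o2 by rewrite -val_eqE /= !inordK.
have d02 : (ord0 : 'I_3) != o2 by rewrite -val_eqE /= inordK.
have [s1 [i [j [H1 E1 ij gi gj]]]] := color _ _ d01.
have [s2 [j' [k [H2 E2 jk gj' gk]]]] := color _ _ d12.
have [s3 [i' [k' [H3 E3 ik gi' gk']]]] := color _ _ d02.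
have ? : j' = j by apply: (@partite s2 s1); rewrite -gj -gj'.
have ? : i' = i by apply: (@partite s3 s1); rewrite -gi -gi'.
have ? : k' = k by apply: (@partite s3 s2); rewrite -gk -gk'.
subst; have s12 : s1 = s2.
  by apply: (@no_triangle s1 s2 s3 i j k) => //; rewrite -?gi -?gj -?gk.
have /setP/(_ (g ord0)) : [set g ord0; g o1] = [set g o1; g o2].
  by apply: Hinj => //; rewrite (pb s1) // (pb s1) // s12.
by rewrite !inE eqxx /= !(inj_eq g_inj) (negPf d01) (negPf d02).
Qed.

End PartiteCopies.

(* A line meets a sphere in at most two points: expand |a v1 + b v2|^2 = (a + b)^2 r. *)
Lemma sphere_collinear (l : nat) (v1 v2 v3 : 'I_l -> int) (a b r : int) :
    a != 0 -> b != 0 -> (forall c, a * v1 c + b * v2 c = (a + b) * v3 c) ->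
    \sum_c v1 c ^+ 2 = r -> \sum_c v2 c ^+ 2 = r -> \sum_c v3 c ^+ 2 = r ->
  v1 =1 v2.
Proof.
move=> a0 b0 lin n1 n2 n3.
have : a * b * \sum_c (v1 c - v2 c) ^+ 2 = 0.
  transitivity (a * (a + b) * \sum_c v1 c ^+ 2 + b * (a + b) * \sum_c v2 c ^+ 2 -
                (a + b) ^+ 2 * \sum_c v3 c ^+ 2); last by rewrite n1 n2 n3; ring.
  rewrite !mulr_sumr -big_split -sumrB /=; apply: eq_bigr => c _.
  by rewrite -exprMn -lin; ring.
move/eqP; rewrite !mulf_eq0 (negPf a0) (negPf b0) /=.
rewrite psumr_eq0 => [/allP all0 c|c _]; last exact: sqr_ge0.
have := all0 c; rewrite mem_index_enum => /(_ isT) /=.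
by rewrite sqrf_eq0 subr_eq0 => /eqP.
Qed.

(** * Popular spheres and the Behrend-type packing *)

Definition sqnorm (l D : nat) (v : {ffun 'I_l -> 'I_D}) : nat := \sum_c v c ^ 2.

(** Pigeonhole: the squared norm takes fewer than [l * D ^ 2 + 1] values on the box of [D ^ l]
    points. *)
Lemma popular_sphere (l D : nat) : (0 < l)%N -> (0 < D)%N ->
  exists r, (D ^ l <= l * D ^ 2 * #|[set v : {ffun 'I_l -> 'I_D} | sqnorm v == r]|)%N.
Proof.
move=> l0 D0.
have norm_lt (v : {ffun 'I_l -> 'I_D}) : (sqnorm v < l * D ^ 2)%N.
  have : (sqnorm v <= \sum_(c < l) D.-1 ^ 2)%N.
    by apply: leq_sum => c _; rewrite leq_exp2r // -ltnS prednK.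
  rewrite sum_nat_const card_ord => /leq_ltn_trans; apply.
  by rewrite ltn_pmul2l // ltn_exp2r // prednK.
have r0 : 'I_(l * D ^ 2) by exists 0%N; rewrite muln_gt0 l0 expn_gt0 D0.
pose S (r : nat) := [set v : {ffun 'I_l -> 'I_D} | sqnorm v == r].
case: (@arg_maxnP 'I_(l * D ^ 2) r0 predT (fun r => #|S r|)) => // r _ rmax.
exists (nat_of_ord r); rewrite -/(S r).
have -> : (D ^ l)%N = #|{: {ffun 'I_l -> 'I_D}}| by rewrite card_ffun !card_ord.
have -> : (l * D ^ 2 * #|S r| = \sum_(r' < l * D ^ 2) #|S r|)%N.
  by rewrite sum_nat_const card_ord.
rewrite -[leqLHS]sum1_card (partition_big (fun v => Ordinal (norm_lt v)) predT) //=.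
apply: leq_sum => r' _.
apply: leq_trans (rmax r' isT); rewrite -sum1_card; apply: eq_leq; apply: eq_bigl => v.
by rewrite inE.
Qed.

Lemma two_points (R : comPzRingType) (i j x x' v v' : R) :
  x + i * v = x' + i * v' -> x + j * v = x' + j * v' -> (i - j) * (v - v') = 0.
Proof.
move=> Ei Ej; transitivity ((x + i * v) - (x + j * v) - ((x' + i * v') - (x' + j * v'))).
  by ring.
by rewrite Ei Ej subrr.
Qed.

(** Eliminating the base points around a triangle with parts [i], [j], [k] leaves the collinearity
    relation needed by [sphere_collinear]. *)
Lemma three_points (R : comPzRingType) (i j k x1 x2 x3 v1 v2 v3 : R) :
    x1 + i * v1 = x3 + i * v3 -> x1 + j * v1 = x2 + j * v2 ->
    x2 + k * v2 = x3 + k * v3 ->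
  (j - i) * v1 + (k - j) * v2 = (j - i + (k - j)) * v3.
Proof.
move=> Ei Ej Ek; apply/subr0_eq.
transitivity ((x1 + j * v1) - (x2 + j * v2) + ((x2 + k * v2) - (x3 + k * v3)) -
              ((x1 + i * v1) - (x3 + i * v3))); first by ring.
by rewrite Ei Ej Ek !subrr addr0 subr0.
Qed.

(** There is one copy for each base point in the box and each direction on a popular sphere, and
    [t * (t * D) ^ l] vertices hold them all. *)
Lemma ex_multi_behrend (t n l D : nat) : (1 < t)%N -> (0 < l)%N -> (0 < D)%N ->
    (t * (t * D) ^ l <= n)%N ->
  (D ^ l * D ^ l <= l * D ^ 2 * ex_multi (complete t) n (complete 3))%N.
Proof.
move=> t1 l0 D0 room; have [r rP] := popular_sphere l0 D0.
pose S := {v : {ffun 'I_l -> 'I_D} | sqnorm v == r}.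
pose I := ({ffun 'I_l -> 'I_D} * S)%type.
pose W := ('I_t * {ffun 'I_l -> 'I_(t * D)})%type.
(* All of [x], [v] are at most [D - 1] and [i] is at most [t - 1], so the sum is at most
   [t * (D - 1)]. *)
have bound (x v : 'I_D) (i : 'I_t) : (x + i * v < t * D)%N.
  have := ltn_ord i; have := ltn_ord x; have := ltn_ord v; nia.
pose w (s : I) i : W := (i, [ffun c => Ordinal (bound (s.1 c) (val s.2 c) i)]).
have Wn : (#|{: W}| <= n)%N by rewrite card_prod card_ffun !card_ord.
have toZ (a i v a' i' v' : nat) : (a + i * v = a' + i' * v')%N ->
    a%:Z + i%:Z * v%:Z = a'%:Z + i'%:Z * v'%:Z.
  by move=> H; rewrite -!PoszM -!PoszD H.
pose phi s i : 'I_n := widen_ord Wn (enum_rank (w s i)).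
have phiE s s' i i' : phi s i = phi s' i' ->
    i = i' /\ forall c, (s.1 c + i * val s.2 c = s'.1 c + i' * val s'.2 c)%N.
  move=> /(congr1 val) /= /val_inj /enum_rank_inj [<- /ffunP H]; split=> // c.
  by have := congr1 val (H c); rewrite !ffunE.
have eqI (s s' : I) (i : 'I_t) : val s.2 =1 val s'.2 ->
    (forall c, s.1 c + i * val s.2 c = s'.1 c + i * val s'.2 c)%N -> s = s'.
  case: s s' => [x v] [x' v'] /= vE; have -> : v = v' by apply/val_inj/ffunP.
  by move=> xE; congr (_, _); apply/ffunP => c; apply/val_inj; have /= /addIn := xE c.
apply: leq_trans (_ : D ^ l * (l * D ^ 2 * #|{: S}|) <= _)%N.
  by rewrite leq_mul2l card_sig -cardsE rP orbT.
rewrite mulnCA leq_mul2l; apply/orP; right.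
have -> : (D ^ l * #|{: S}|)%N = #|{: I}| by rewrite card_prod card_ffun !card_ord.
apply: (@ex_multi_partite_lower _ _ _ phi) => //.
- by move=> s s' i i' /phiE[].
- move=> s s' i j ij /phiE[_ Ei] /phiE[_ Ej]; apply: (eqI _ _ i) => // c.
  have : ((i%:Z - j%:Z) * ((val s.2 c)%:Z - (val s'.2 c)%:Z) == 0).
    by apply/eqP; exact: (two_points (toZ _ _ _ _ _ _ (Ei c)) (toZ _ _ _ _ _ _ (Ej c))).
  by rewrite mulf_eq0 !subr_eq0 !eqz_nat => /orP[/idPn|/eqP/val_inj].
- move=> s1 s2 s3 i j k ij jk ik /phiE[_ Ei] /phiE[_ Ej] /phiE[_ Ek].
  apply: (eqI _ _ j) => //.
  have normE (s : I) : \sum_c ((val s.2 c)%:Z) ^+ 2 = r%:Z.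
    by case: s => x [v /= /eqP <-]; rewrite /sqnorm -natz natr_sum;
      apply: eq_bigr => c _; rewrite natrX natz.
  have : (fun c => (val s1.2 c)%:Z) =1 (fun c => (val s2.2 c)%:Z).
    apply: (@sphere_collinear _ _ _ (fun c => (val s3.2 c)%:Z)
              (j%:Z - i%:Z) (k%:Z - j%:Z) r); rewrite ?normE //.
    + by rewrite subr_eq0 eqz_nat eq_sym.
    + by rewrite subr_eq0 eqz_nat eq_sym.
    + move=> c.
      exact: (three_points (toZ _ _ _ _ _ _ (Ei c)) (toZ _ _ _ _ _ _ (Ej c))
                           (toZ _ _ _ _ _ _ (Ek c))).
  by move=> H c; apply/val_inj; have [] := H c.
Qed.

(* Choice of parameters and asymptotics *)
From mathcomp Require Import all_classical all_reals all_analysis.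
Import Order.TTheory GRing.Theory Num.Theory numFieldNormedType.Exports.
Local Open Scope classical_set_scope.
Local Open Scope ring_scope.

Lemma natr_le_expR (R : realType) (n : nat) : n%:R <= expR (n%:R : R).
Proof. by apply: le_trans (expR_ge1Dx _); rewrite lerDr. Qed.

(** Take [l] the integer part of [m = sqrt (ln n)] and [D] that of [n ^ (1/l) / t ^ 2]. The losses
    [(2 * t ^ 2) ^ (2 * l)] from rounding and [l * D ^ 2] from the sphere are both exponential in
    [l]. *)
Lemma ex_multi_triangle_lower (R : realType) (t n : nat) : (3 <= t)%N -> (0 < n)%N ->
    t%:R ^+ 2 + 1 <= Num.sqrt (ln n%:R) :> R ->
  n%:R ^+ 2 * expR (- ((9 + 4 * t%:R ^+ 2) * Num.sqrt (ln n%:R))) <=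
    (ex_multi (complete t) n (complete 3))%:R :> R.
Proof.
move=> t3 n0; set L : R := ln n%:R; set tau : R := t%:R => big.
have tau3 : 3 <= tau by rewrite ler_nat.
have tau2 : 0 < tau ^+ 2 by apply: exprn_gt0; lra.
have L0 : 0 <= L by rewrite ln_ge0 // ler1n.
have sq := sqr_sqrtr L0.
have expL : expR L = n%:R by rewrite lnK // posrE ltr0n.
set m : R := Num.sqrt L in big sq *.
have m0 : 0 <= m by exact: sqrtr_ge0.
clearbody L m.
have [l lm ml] : exists2 l : nat, l%:R <= m & m < l%:R + 1.
  by exists (Num.truncn m); rewrite ?natr1; case/andP: (truncn_itv m0).
have lam_tau : tau ^+ 2 <= l%:R.
  have : (t ^ 2 < l.+1)%N by rewrite -(ltr_nat R) natrX -natr1; lra.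
  by rewrite ltnS -(ler_nat R) natrX.
have lam1 : 1 <= l%:R :> R by apply: le_trans lam_tau; apply: exprn_ege1; lra.
have l0 : (0 < l)%N by move: lam1; rewrite ler1n.
(* Here [a] is the [l]-th root of [n]; its bounds follow from [l <= m <= 2 * l]. *)
have [a [al a_ge a_le]] : exists a : R,
    [/\ a ^+ l = n%:R, expR l%:R <= a & a <= expR l%:R ^+ 4].
  have lam_gt0 : 0 < l%:R :> R by rewrite ltr0n.
  exists (expR (L / l%:R)); split.
  - by rewrite -expRM_natl mulrC divfK // gt_eqF.
  - by rewrite ler_expR ler_pdivlMr // -sq expr2; apply: ler_pM.
  - rewrite -expRM_natl ler_expR ler_pdivrMr //.
    apply: le_trans (_ : (2 * l%:R) * (2 * l%:R) <= _); last by lra.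
    by rewrite -sq expr2; apply: ler_pM => //; lra.
have a_tau : tau ^+ 2 <= a.
  by apply: le_trans a_ge; apply: le_trans lam_tau _; exact: natr_le_expR.
have a0 : 0 <= a by apply: le_trans a_tau; exact: ltW.
have [D D0 [Da aD]] : exists2 D : nat, (0 < D)%N &
    D%:R * tau ^+ 2 <= a /\ a <= 2 * tau ^+ 2 * D%:R.
  have quot1 : 1 <= a / tau ^+ 2 by rewrite ler_pdivlMr // mul1r.
  have /andP[] := truncn_itv (le_trans ler01 quot1).
  have : (0 < Num.truncn (a / tau ^+ 2))%N by rewrite truncn_gt0.
  move: (Num.truncn _) => D D0; rewrite -natr1 ler_pdivlMr // ltr_pdivrMr // => Da aD.
  exists D => //; split=> //; apply: le_trans (ltW aD) _.
  rewrite mulrAC ler_wpM2r ?sqr_ge0 //.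
  have : 1 <= D%:R :> R by rewrite ler1n.
  by move: (D%:R : R) => d; lra.
(* The leading factor [t] is absorbed into [t ^ l], leaving [(t ^ 2 * D) ^ l <= a ^ l = n]. *)
have room : (t * (t * D) ^ l <= n)%N.
  rewrite -(ler_nat R) natrM natrX natrM -/tau.
  have tau0 : 0 <= tau by lra.
  apply: le_trans (_ : tau ^+ l * (tau * D%:R) ^+ l <= _).
    rewrite ler_wpM2r ?exprn_ge0 ?mulr_ge0 //.
    by rewrite -{1}[tau]expr1 ler_weXn2l //; lra.
  rewrite -al -exprMn mulrA -expr2; apply: lerXn2r; rewrite ?nnegrE ?mulr_ge0 ?sqr_ge0 //.
  by rewrite mulrC.
have := ex_multi_behrend (ltnW t3) l0 D0 room.
rewrite -(ler_nat R) !natrM !natrX; move: (ex_multi _ _ _) => X beh.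
set lam : R := l%:R in beh *; set d : R := D%:R in Da aD beh.
pose E := expR (4 * tau ^+ 2 * lam).
have E_ge : (2 * tau ^+ 2) ^+ l * (2 * tau ^+ 2) ^+ l <= E.
  rewrite /E (_ : 4 * tau ^+ 2 * lam = lam * (2 * tau ^+ 2) + lam * (2 * tau ^+ 2));
    last by lra.
  rewrite expRD /lam expRM_natl; apply: ler_pM; rewrite ?exprn_ge0 ?mulr_ge0 ?sqr_ge0 //;
    apply: lerXn2r; rewrite ?nnegrE ?mulr_ge0 ?sqr_ge0 ?expR_ge0 //;
    by apply: le_trans (expR_ge1Dx _); rewrite lerDr.
have nE : n%:R ^+ 2 <= E * (d ^+ l * d ^+ l).
  apply: le_trans (_ : (2 * tau ^+ 2 * d) ^+ l * (2 * tau ^+ 2 * d) ^+ l <= _).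
    have n_le : n%:R <= (2 * tau ^+ 2 * d) ^+ l.
      by rewrite -al; apply: lerXn2r; rewrite ?nnegrE ?mulr_ge0 ?sqr_ge0.
    by rewrite expr2; apply: ler_pM.
  rewrite exprMn mulrACA; apply: ler_wpM2r E_ge.
  by rewrite mulr_ge0 // exprn_ge0.
(* The exponent is 9 = 1 + 2 * 4, from [lam <= expR lam] and [d <= expR lam ^+ 4]. *)
have ld : lam * d ^+ 2 <= expR (9 * lam).
  have d_le : d <= expR lam ^+ 4.
    apply: le_trans a_le; apply: le_trans Da; rewrite ler_peMr //.
    by apply: exprn_ege1; lra.
  apply: le_trans (_ : expR lam * (expR lam ^+ 4) ^+ 2 <= _).
    apply: ler_pM; rewrite ?sqr_ge0 // ?natr_le_expR //.
    by apply: lerXn2r; rewrite ?nnegrE ?exprn_ge0 ?expR_ge0.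
  by rewrite -exprM -exprS expRM_natl.
have main : n%:R ^+ 2 <= E * expR (9 * lam) * X%:R.
  apply: le_trans nE _; rewrite -mulrA ler_wpM2l ?expR_ge0 //.
  by apply: le_trans beh _; rewrite ler_wpM2r.
rewrite expRN ler_pdivrMr ?expR_gt0 //; apply: le_trans main _.
rewrite mulrC ler_wpM2l // -expRD ler_expR -mulrDl addrC ler_wpM2l //.
by rewrite addr_ge0 // mulr_ge0 // sqr_ge0.
Qed.

Theorem theorem1p3 (R : realType) (t : nat) (ht : (3 <= t)%N) :
  (exists2 g : nat -> R,
     g =O_\oo (fun n : nat => Num.sqrt (ln (n%:R : R))) &
     \forall n \near \oo,
       n%:R ^+ 2 * expR (- g n) <= (ex_multi (complete t) n (complete 3))%:R) /\
  (fun n : nat => (ex_multi (complete t) n (complete 3))%:R : R)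
    =o_\oo (fun n : nat => n%:R ^+ 2 : R).
Proof.
have K0 : 0 < 9 + 4 * t%:R ^+ 2 :> R.
  by rewrite ltr_pwDl // mulr_ge0 // sqr_ge0.
split.
  exists (fun n => (9 + 4 * t%:R ^+ 2) * Num.sqrt (ln n%:R)).
    apply/eqO_exP; exists (9 + 4 * t%:R ^+ 2) => //.
    by apply: nearW => n; rewrite normrM (gtr0_norm K0).
  (* From this threshold on, [sqrt (ln n)] is at least [t ^ 2 + 1], as the explicit bound
     requires. *)
  pose x : R := expR ((t%:R ^+ 2 + 1) ^+ 2).
  exists (Num.bound x) => // n /= nx.
  have xn : x <= n%:R.
    by apply/ltW/(lt_le_trans (archi_boundP (expR_ge0 _))); rewrite ler_nat.
  have n0 : (0 < n)%N by rewrite -(ltr0n R); apply: lt_le_trans xn; exact: expR_gt0.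
  apply: ex_multi_triangle_lower => //.
  have t2 : 0 <= t%:R ^+ 2 + 1 :> R by rewrite addr_ge0 // sqr_ge0.
  rewrite -(ger0_norm t2) -sqrtr_sqr ler_sqrt; last first.
    by rewrite ln_ge0 // ler1n.
  by rewrite -ler_expR lnK // posrE ltr0n.
apply/eqoP => eps eps0.
have [n0 H] := ex_multi_triangle_upper ht eps0.
exists n0 => // n /= /H; rewrite !ger0_norm //.
Qed.
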